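(* Let $s,t,r,\ell$ be integers with $2\le t<s$, $s-1=r(t-1)+\ell$, $0\le\ell<t-1$ and $\ell<r$. Then $K_s$ has a strong phase transition at $f(n)=\mathbf{Q}(t,n)$.
   Context: All graphs are simple. For integers $t\ge2$, $\mathbf{Q}(t,n)$ is the minimum independence number over all $K_t$-free graphs on $n$ vertices. For a graph $H$ and a function $f$, $\mathbf{RT}(n,H,f(n))$ denotes the maximum number of edges of an $H$-free graph on $n$ vertices with independence number less than $f(n)$ (taken to be $0$ if no such graph exists). Set $\overline{\rho\tau}(H,f)=\limsup_{n\to\infty}\mathbf{RT}(n,H,f(n))/n^2$ and $\underline{\rho\tau}(H,f)=\liminf_{n\to\infty}\mathbf{RT}(n,H,f(n))/n^2$. Phase transitions: given a graph $H$ and functions $g(n)\le f(n)$, $H$ has a phase transition from $f$ to $g$ if $\overline{\rho\tau}(H,g)<\underline{\rho\tau}(H,f)$. Given a (positive) function $\varphi(n)\to0$, $H$ has a $\varphi$-phase-transition at $f$ if $H$ has a phase transition from $f$ to $\varphi f$. $H$ has a strong phase transition at $f$ if it has a $\varphi$-phase-transition at $f$ for every $\varphi$ tending to $0$. *)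

(* Defs.v *)
From HB Require Import structures.
From mathcomp Require Import all_boot all_order all_algebra.
From mathcomp Require Import all_classical all_reals all_analysis.

Set Implicit Arguments.
Unset Strict Implicit.
Unset Printing Implicit Defensive.

Import Order.TTheory GRing.Theory Num.Theory.
Import numFieldNormedType.Exports.

(* Both finset and classical_sets provide [set x | P]; the graph-theoretic part
   uses the finset version. *)
Local Open Scope set_scope.

Record sgraph (T : finType) := SGraph {
  edges : {set {set T}};
  edgesP : [forall e in edges, #|e| == 2] }.

HB.instance Definition _ (T : finType) := [isSub for @edges T].
HB.instance Definition _ (T : finType) := [Finite of sgraph T by <:].

Definition all_pairs (T : finType) : {set {set T}} := [set e : {set T} | #|e| == 2].

Lemma all_pairsP (T : finType) : [forall e in all_pairs T, #|e| == 2].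
Proof. by apply/forall_inP => e; rewrite inE. Qed.

Definition complete_graph (n : nat) : sgraph 'I_n := SGraph (all_pairsP 'I_n).

(* G contains no (not necessarily induced) copy of H. *)
Definition is_free (V T : finType) (H : sgraph V) (G : sgraph T) : bool :=
  ~~ [exists f : {ffun V -> T},
        injectiveb f && [forall e in edges H, f @: e \in edges G]].

Definition independent (T : finType) (G : sgraph T) (A : {set T}) : bool :=
  [forall e in edges G, ~~ (e \subset A)].

Definition alpha (T : finType) (G : sgraph T) : nat :=
  \max_(A : {set T} | independent G A) #|A|.

(* The default value n of the iterated minimum is harmless: every graph on n
   vertices has alpha <= n, and for t >= 2 the edgeless graph is K_t-free with
   alpha = n. *)
Definition Q (t n : nat) : nat :=
  \big[minn/n]_(G : sgraph 'I_n | is_free (complete_graph t) G) alpha G.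

Section RamseyTuran.
Variable R : realType.
Local Open Scope classical_set_scope.
Local Open Scope ring_scope.

(* An empty \max is 0. *)
Definition RT (V : finType) (n : nat) (H : sgraph V) (x : R) : nat :=
  (\max_(G : sgraph 'I_n | is_free H G && ((alpha G)%:R < x)%R) #|edges G|)%N.

Definition RT_density (V : finType) (H : sgraph V) (f : nat -> R) (n : nat) : \bar R :=
  ((RT n H (f n))%:R / n%:R ^+ 2)%:E.

Definition rt_upper (V : finType) (H : sgraph V) (f : nat -> R) : \bar R :=
  limn_esup (RT_density H f).

Definition rt_lower (V : finType) (H : sgraph V) (f : nat -> R) : \bar R :=
  limn_einf (RT_density H f).

(* The requirement g <= f is asymptotic: it must hold for all large n. *)
Definition phase_transition (V : finType) (H : sgraph V) (f g : nat -> R) : Prop :=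
  (\forall n \near \oo, g n <= f n) /\ (rt_upper H g < rt_lower H f)%E.

Definition phi_phase_transition (V : finType) (H : sgraph V)
    (phi f : nat -> R) : Prop :=
  phase_transition H f (fun n => phi n * f n).

Definition strong_phase_transition (V : finType) (H : sgraph V)
    (f : nat -> R) : Prop :=
  forall phi : nat -> R, (forall n, 0 < phi n) ->
    phi n @[n --> \oo] --> (0 : R) -> phi_phase_transition H phi f.

End RamseyTuran.

(* Main.v *)
(* Put E = 2 r^2 t.

   Upper bound (Erdos-Sos).  If alpha(G) = o(Q(t,n)), then, Q(t,.) being
   subadditive, every linear-size vertex set of G contains a K_t.  If moreover all
   degrees are at least (1 - 1/r - 1/E) m in a subgraph on m vertices, then for any
   clique K of size j < rt linearly many vertices see the same at least
   j - floor(j/r) vertices of K; a K_t among those vertices gives a clique of size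
   at least j - floor(j/r) + t > j.  Hence there is a K_{rt}, which contains K_s.
   So the edge density is at most about (1/2)(1 - 1/r - 1/E).

   Lower bound.  The join of r copies of a K_t-free graph on n/r vertices has
   clique number at most r(t-1) <= s-1 and density (1/2)(1 - 1/r).  Its
   independence number has to be strictly below Q(t,n), so one needs
   Q(t,n/2) < Q(t,n) for large n.  If this failed, deleting the closed
   neighbourhood of any vertex of an extremal graph would show that all degrees are
   about n/2 or more; the clique-growing argument with r = 2 then yields a
   K_p-free set of linear size, p = ceil(t/2), so n = O(Q(t,n)^(p-1)) by the
   Erdos-Szekeres bound.  This contradicts Q(2p-1,n) = n^(2/(2p-1)+o(1)), which is
   Erdos' deletion method. *)

Require Import Defs.
From mathcomp Require Import all_boot all_order all_algebra zify.

Set Implicit Arguments.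
Unset Strict Implicit.
Unset Printing Implicit Defensive.

(** * Cliques and stable sets *)

Section Relations.
Variables (T : finType) (e : rel T).
Implicit Types (u v : T) (A K U : {set T}).

Definition clique K := [forall u in K, forall v in K, (u != v) ==> e u v].
Definition stable A := [forall u in A, forall v in A, ~~ e u v].

(** Relative to a vertex set [U], so that induced subgraphs need no new vertex type. *)
Definition Kfree t U := forall K, K \subset U -> clique K -> #|K| < t.
Definition alpha_le k U := forall A, A \subset U -> stable A -> #|A| <= k.

Lemma cliqueP K : reflect {in K &, forall u v, u != v -> e u v} (clique K).
Proof.
apply: (iffP forall_inP) => [cK u v uK vK|cK u uK].
  by have /forall_inP/(_ v vK)/implyP := cK u uK.
by apply/forall_inP => v vK; apply/implyP; exact: cK.
Qed.

Lemma stableP A : reflect {in A &, forall u v, ~~ e u v} (stable A).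
Proof.
apply: (iffP forall_inP) => [sA u v uA vA|sA u uA].
  by have /forall_inP/(_ v vA) := sA u uA.
by apply/forall_inP => v vA; exact: sA.
Qed.

Lemma clique0 : clique set0.
Proof. by apply/cliqueP => u v; rewrite inE. Qed.

Lemma stable0 : stable set0.
Proof. by apply/stableP => u v; rewrite inE. Qed.

Lemma sub_clique K K' : K' \subset K -> clique K -> clique K'.
Proof.
by move=> /subsetP sK /cliqueP cK; apply/cliqueP => u v /sK uK /sK vK; exact: cK.
Qed.

Lemma KfreeS t U U' : U' \subset U -> Kfree t U -> Kfree t U'.
Proof. by move=> sU fU K sK; apply: fU; exact: fintype.subset_trans sU. Qed.

Lemma alpha_leS k U U' : U' \subset U -> alpha_le k U -> alpha_le k U'.
Proof. by move=> sU fU K sK; apply: fU; exact: fintype.subset_trans sU. Qed.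

Lemma Kfree_leq t t' U : t <= t' -> Kfree t U -> Kfree t' U.
Proof. by move=> tt' fU K sK cK; exact: leq_trans (fU _ sK cK) tt'. Qed.

Lemma exists_sub_card A n : n <= #|A| -> exists2 B : {set T}, B \subset A & #|B| = n.
Proof.
move=> nA; have /card_gt0P[B] : 0 < #|[set B : {set T} | B \subset A & #|B| == n]|.
  by rewrite cards_draws bin_gt0.
by rewrite inE => /andP[BA /eqP Bn]; exists B.
Qed.

End Relations.

Section Transport.
Variables (T1 T2 : finType) (f : T1 -> T2) (e1 : rel T1) (e2 : rel T2).
Hypotheses (f_inj : injective f) (fE : forall u v, e1 u v = e2 (f u) (f v)).

Lemma Kfree_imset t (U : {set T1}) : Kfree e2 t (f @: U) -> Kfree e1 t U.
Proof.
move=> fU K sK /cliqueP cK; rewrite -(card_imset _ f_inj).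
apply: fU; first exact: imsetS.
apply/cliqueP => _ _ /imsetP[u uK ->] /imsetP[v vK ->] fuv.
by rewrite -fE; apply: cK => //; apply: contraNneq fuv => ->.
Qed.

Lemma alpha_le_imset k (U : {set T1}) : alpha_le e2 k (f @: U) -> alpha_le e1 k U.
Proof.
move=> fU K sK /stableP cK; rewrite -(card_imset _ f_inj).
apply: fU; first exact: imsetS.
apply/stableP => _ _ /imsetP[u uK ->] /imsetP[v vK ->].
by rewrite -fE; apply: cK.
Qed.

End Transport.

(** * Simple graphs as symmetric irreflexive relations *)

Section Graphs.
Variable T : finType.
Implicit Types (G : sgraph T) (e : rel T) (A K : {set T}).

Definition adj G : rel T := fun u v => [set u; v] \in edges G.

Lemma edges_card2 G E : E \in edges G -> #|E| == 2.
Proof. by move=> EG; have /forall_inP/(_ E EG) := edgesP G. Qed.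

Lemma adj_sym G : symmetric (adj G).
Proof. by move=> u v; rewrite /adj setUC. Qed.

Lemma adj_irr G : irreflexive (adj G).
Proof.
by move=> u; apply/negP => /edges_card2; rewrite setUid cards1.
Qed.

(** An edge is a two-element clique of [e], spelled out so that [cliqueP] applies. *)
Definition graph_edges e :=
  [set E in all_pairs T | [forall u in E, forall v in E, (u != v) ==> e u v]].

Lemma graph_edgesP e : [forall E in graph_edges e, #|E| == 2].
Proof. by apply/forall_inP => E; rewrite !inE => /andP[]. Qed.

Definition graph_of e := SGraph (graph_edgesP e).

Lemma adj_graph_of e : symmetric e -> irreflexive e -> adj (graph_of e) =2 e.
Proof.
move=> sym_e irr_e u v; rewrite /adj !inE cards2.
have [->|uv] := eqVneq u v; first by rewrite irr_e.
apply/(@cliqueP _ e)/idP => [|euv x y].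
  by apply => //; rewrite !inE eqxx ?orbT.
rewrite !inE => /orP[]/eqP-> /orP[]/eqP->; rewrite ?eqxx // => _.
by rewrite sym_e.
Qed.

Lemma independent_stable G A : independent G A = stable (adj G) A.
Proof.
apply/forall_inP/stableP => [iA u v uA vA|sA E EG].
  apply/negP => /iA/negP; apply; apply/subsetP => x.
  by rewrite !inE => /orP[]/eqP->.
have /cards2P[u [v [_ Euv]]] := edges_card2 EG.
apply/negP => /subsetP EA.
have uE : u \in E by rewrite Euv !inE eqxx.
have vE : v \in E by rewrite Euv !inE eqxx orbT.
by have := sA u v (EA u uE) (EA v vE); rewrite /adj -Euv EG.
Qed.

Lemma alphaP G k : reflect (alpha_le (adj G) k [set: T]) (alpha G <= k).
Proof.
apply: (iffP idP) => [ak A _ sA|ak].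
  by apply: leq_trans ak; apply: leq_bigmax_cond; rewrite independent_stable.
by apply/bigmax_leqP => A; rewrite independent_stable; exact: ak.
Qed.

Lemma is_freeP G t : reflect (Kfree (adj G) t [set: T]) (is_free (complete_graph t) G).
Proof.
apply: (iffP idP) => [/existsPn fG K _ /cliqueP cK|fG].
  rewrite ltnNge; apply/negP => tK.
  pose f := [ffun i : 'I_t => enum_val (widen_ord tK i)].
  have f_inj : injective f.
    by move=> i j; rewrite !ffunE => /enum_val_inj/(congr1 val)/= ?; exact: val_inj.
  have fb : injectiveb f by apply/injectiveP.
  have /negP[] := fG f; rewrite fb /=.
  apply/forall_inP => E; rewrite inE => /cards2P[i [j [ij ->]]].
  rewrite imsetU !imset_set1; apply: cK; rewrite ?ffunE ?enum_valP //.
  by rewrite (inj_eq enum_val_inj) -(inj_eq val_inj) /=.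
apply/existsP => -[f /andP[/injectiveP f_inj /forall_inP fE]].
suff : #|f @: [set: 'I_t]| < t by rewrite card_imset // cardsT card_ord ltnn.
apply: fG; first exact: finset.subsetT.
apply/cliqueP => _ _ /imsetP[i _ ->] /imsetP[j _ ->] ij.
have : [set i; j] \in edges (complete_graph t).
  by rewrite !inE cards2 (contraNneq _ ij) // => ->.
by move=> /fE; rewrite imsetU !imset_set1.
Qed.

Lemma handshake G : 2 * #|edges G| = \sum_u #|[set v | adj G u v]|.
Proof.
transitivity (\sum_(E in edges G) \sum_(u in E) 1).
  rewrite mulnC -sum_nat_const; apply: eq_bigr => E /edges_card2/eqP E2.
  by rewrite sum1_card.
rewrite (exchange_big_dep predT) //=; apply: eq_bigr => u _.
rewrite sum1_card -(card_in_imset (f := fun v => [set u; v])).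
  apply: eq_card => E; rewrite unfold_in /=; apply/andP/imsetP => [[EG uE]|[v]].
    have /cards2P[x [y [_ Exy]]] := edges_card2 EG.
    move: uE; rewrite Exy !inE => /orP[]/eqP->.
      by exists y => //; rewrite inE /adj -Exy.
    by exists x; rewrite ?inE /adj setUC -?Exy.
  by rewrite inE /adj => uv ->; rewrite uv !inE eqxx.
move=> v w; rewrite !inE => uv uw /setP vw.
have uNv x : adj G u x -> x != u by apply: contraTneq => ->; rewrite adj_irr.
by have := vw v; rewrite !inE eqxx orbT (negbTE (uNv v uv)) /= => /esym/eqP.
Qed.

End Graphs.

(** * The function Q *)

Lemma bigminn_le (I : eqType) (s : seq I) (P : pred I) (F : I -> nat) n j :
  j \in s -> P j -> \big[minn/n]_(i <- s | P i) F i <= F j.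
Proof.
elim: s => // a s IHs; rewrite inE big_cons => /predU1P[<- ->|js Pj].
  exact: geq_minl.
by case: ifP => _; [rewrite geq_min IHs ?orbT|exact: IHs].
Qed.

Lemma Q_le (T : finType) (e : rel T) t k (U : {set T}) :
  symmetric e -> irreflexive e -> Kfree e t U -> alpha_le e k U -> Q t #|U| <= k.
Proof.
move=> sym_e irr_e fU aU; pose f (i : 'I_#|U|) : T := enum_val i.
pose e1 : rel 'I_#|U| := fun i j => e (f i) (f j).
have f_inj : injective f by exact: enum_val_inj.
have sub_f : f @: [set: 'I_#|U|] \subset U.
  by apply/subsetP => _ /imsetP[i _ ->]; exact: enum_valP.
have adjE i j : adj (graph_of e1) i j = e (f i) (f j).
  by apply: adj_graph_of => [{}i {}j|{}i]; [exact: sym_e|exact: irr_e].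
apply: (@leq_trans (alpha (graph_of e1))).
  apply: bigminn_le; first exact: mem_index_enum.
  apply/is_freeP; apply: (Kfree_imset f_inj adjE).
  exact: KfreeS sub_f fU.
apply/alphaP; apply: (alpha_le_imset f_inj adjE).
exact: alpha_leS sub_f aU.
Qed.

(** If the iterated minimum returns its default [n], the edgeless graph attains it. *)
Lemma Q_attained t n : 2 <= t ->
  exists e : rel 'I_n, [/\ symmetric e, irreflexive e,
    Kfree e t [set: 'I_n] & alpha_le e (Q t n) [set: 'I_n]].
Proof.
move=> t2.
have [Qn|[G fG QG]] : Q t n = n \/
    exists2 G : sgraph 'I_n, is_free (complete_graph t) G & Q t n = alpha G.
  rewrite /Q; apply: (big_ind (fun x => x = n \/
      exists2 G : sgraph 'I_n, is_free (complete_graph t) G & x = alpha G)).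
  - by left.
  - by move=> x y hx hy; rewrite /minn; case: ifP.
  - by move=> G fG; right; exists G.
- exists (fun _ _ => false); split => // [K _ /cliqueP cK|A _ _].
    apply: leq_trans t2; rewrite ltnS leqNgt; apply/negP => /card_gt1P[u [v [uK vK]]].
    by move=> /cK -/(_ uK vK).
  by rewrite Qn; apply: leq_trans (max_card _) _; rewrite card_ord.
- exists (adj G); split; [exact: adj_sym|exact: adj_irr|exact/is_freeP|].
  by apply/alphaP; rewrite QG.
Qed.

Lemma leq_Q t m n : 2 <= t -> m <= n -> Q t m <= Q t n.
Proof.
move=> t2 mn; have [e [sym_e irr_e fe ae]] := Q_attained n t2.
have [|U _ Um] := @exists_sub_card _ [set: 'I_n] m; first by rewrite cardsT card_ord.
rewrite -Um; apply: Q_le sym_e irr_e _ _.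
  exact: KfreeS (finset.subsetT _) fe.
exact: alpha_leS (finset.subsetT _) ae.
Qed.

Lemma Q_anti t t' n : 2 <= t -> t <= t' -> Q t' n <= Q t n.
Proof.
move=> t2 tt'; have [e [sym_e irr_e fe ae]] := Q_attained n t2.
rewrite -[X in Q t' X](card_ord n) -cardsT; apply: Q_le sym_e irr_e _ ae.
exact: Kfree_leq tt' fe.
Qed.

Lemma Q_gt0 t n : 2 <= t -> 0 < n -> 0 < Q t n.
Proof.
move=> t2; case: n => // n _; have [e [_ irr_e _ ae]] := Q_attained n.+1 t2.
rewrite -(cards1 (@ord0 n)); apply: ae; first exact: finset.subsetT.
by apply/stableP => u v; rewrite !inE => /eqP-> /eqP->; rewrite irr_e.
Qed.

(** * Disjoint copies and joins of a graph *)

Section Products.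
Variables (I T : finType).
Implicit Types A : {set I * T}.

Definition slice i A : {set T} := [set u | (i, u) \in A].

Lemma card_slices A : #|A| = \sum_i #|slice i A|.
Proof.
rewrite -sum1_card (partition_big fst predT) //=; apply: eq_bigr => i _.
rewrite sum1_card -(card_imset (slice i A) (f := pair i)) => [|u v [] //].
apply: eq_card => -[j u]; rewrite unfold_in /=; apply/andP/imsetP => [[jA /eqP <-]|[v]].
  by exists u; rewrite ?inE.
by rewrite inE => iv [-> ->].
Qed.

Lemma card_slice_le k A : (forall i, #|slice i A| <= k) -> #|A| <= #|I| * k.
Proof.
by move=> Ak; rewrite card_slices -sum_nat_const; exact: leq_sum.
Qed.

(** Cliques of [copies] and stable sets of [join] never meet two copies and are bounded here; the
    two dual cases go through [card_slice_le]. *)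
Lemma card_fst_const k A : (forall i, #|slice i A| <= k) ->
  {in A &, forall x y, x.1 = y.1} -> #|A| <= k.
Proof.
move=> Ak Ac; have [->|[x xA]] := set_0Vmem A; first by rewrite cards0.
apply: leq_trans (Ak x.1); rewrite -(card_imset (slice x.1 A) (f := pair x.1)) => [|u v [] //].
apply/subset_leq_card/subsetP => y yA; apply/imsetP; exists y.2.
  by rewrite inE -(Ac y x yA xA) -surjective_pairing.
by rewrite -(Ac y x yA xA) -surjective_pairing.
Qed.

Variable e : rel T.

Definition copies : rel (I * T) := fun x y => (x.1 == y.1) && e x.2 y.2.
Definition join : rel (I * T) := fun x y => (x.1 != y.1) || e x.2 y.2.

Lemma Kfree_copies t : Kfree e t [set: T] -> Kfree copies t [set: I * T].
Proof.
move=> fe K _ /cliqueP cK; have t0 : 0 < t.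
  by rewrite -(cards0 T); apply: fe; [exact: finset.subsetT|exact: clique0].
rewrite -(prednK t0) ltnS; apply: card_fst_const => [i|x y xK yK].
  rewrite -ltnS (prednK t0); apply: fe; first exact: finset.subsetT.
  apply/cliqueP => u v; rewrite !inE => iu iv uv.
  have := cK _ _ iu iv; rewrite /copies eqxx /=; apply.
  by apply: contraNneq uv => -[->].
have [->//|xy] := eqVneq x y.
by have /andP[/eqP] := cK _ _ xK yK xy.
Qed.

Lemma alpha_le_copies k : alpha_le e k [set: T] ->
  alpha_le copies (#|I| * k) [set: I * T].
Proof.
move=> ae A _ /stableP sA; apply: card_slice_le => i.
apply: ae; first exact: finset.subsetT.
apply/stableP => u v; rewrite !inE => iu iv.
by have := sA _ _ iu iv; rewrite /copies eqxx.
Qed.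

Lemma Kfree_join t : Kfree e t.+1 [set: T] ->
  Kfree join (#|I| * t).+1 [set: I * T].
Proof.
move=> fe K _ /cliqueP cK; rewrite ltnS; apply: card_slice_le => i; rewrite -ltnS.
apply: fe; first exact: finset.subsetT.
apply/cliqueP => u v; rewrite !inE => iu iv uv.
have := cK _ _ iu iv; rewrite /join eqxx /=; apply.
by apply: contraNneq uv => -[->].
Qed.

Lemma alpha_le_join k : alpha_le e k [set: T] -> alpha_le join k [set: I * T].
Proof.
move=> ae A _ /stableP sA; apply: card_fst_const => [i|x y xA yA].
  apply: ae; first exact: finset.subsetT.
  apply/stableP => u v; rewrite !inE => iu iv.
  by have := sA _ _ iu iv; rewrite /join eqxx.
by apply/eqP; apply: contraTT (sA _ _ xA yA) => xy; rewrite /join xy.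
Qed.

End Products.

Lemma Q_mul t j n : 2 <= t -> Q t (j * n) <= j * Q t n.
Proof.
move=> t2; have [e [sym_e irr_e fe ae]] := Q_attained n t2.
have <- : #|[set: 'I_j * 'I_n]| = j * n by rewrite cardsT card_prod !card_ord.
have <- : #|'I_j| * Q t n = j * Q t n by rewrite card_ord.
apply: (@Q_le _ (copies e)).
- by move=> x y; rewrite /copies eq_sym sym_e.
- by move=> x; rewrite /copies irr_e andbF.
- exact: Kfree_copies.
- exact: alpha_le_copies.
Qed.

(** * Growing cliques *)

(* In clique_step: j = #|K|, m = #|W|, s1 counts the adjacent pairs in K x W, x the
   vertices of W seeing at least a vertices of K, and q = j %/ r. *)
Lemma growth_arith (r p j m a q rho s1 x : nat) (E := 2 * r ^ 2 * p) :
  j = q * r + rho -> rho < r -> a + q = j -> j < r * p ->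
  j * (E * m) <= E * s1 + j * ((2 * r * p).+1 * m) ->
  s1 + m <= a * m + x * j.+1 -> m <= E * x.
Proof.
move=> jE rho_lt aq Krp deg_sum sum_le.
have sumE : E * s1 + E * m <= E * (a * m) + E * (x * j.+1).
  by rewrite -!mulnDr leq_mul2l sum_le orbT.
have step1 : q * (E * m) + E * m <= E * (x * j.+1) + j * ((2 * r * p).+1 * m).
  have : j * (E * m) = E * (a * m) + q * (E * m) by rewrite -aq mulnDl mulnCA.
  lia.
have EqE : E = 2 * (r * p) * r by rewrite /E; nia.
(* As [E = 2rp * r], the part [q * r] of [j] gives exactly [q * (E * m)], which cancels that term of
   [step1]. *)
have jm : j * ((2 * r * p).+1 * m) = q * (E * m) + 2 * (r * p) * rho * m + j * m.
  rewrite EqE; move: jE; clear; move=> ->. nia.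
have step2 : E * m <= E * (x * j.+1) + 2 * (r * p) * rho * m + j * m by lia.
have step3 : 2 * (r * p) * m <= E * (x * j.+1) + j * m.
  have : 2 * (r * p) * rho.+1 * m <= E * m by rewrite EqE !leq_mul.
  have -> : 2 * (r * p) * rho.+1 * m = 2 * (r * p) * rho * m + 2 * (r * p) * m.
    by rewrite mulnS mulnDl addnC.
  lia.
have rp_gt0 : 0 < r * p by exact: leq_ltn_trans Krp.
rewrite -(leq_pmul2l rp_gt0).
have : E * (x * j.+1) <= E * x * (r * p) by rewrite mulnA leq_mul2l Krp orbT.
have : j * m <= r * p * m by rewrite leq_mul2r ltnW ?orbT.
rewrite (mulnC (r * p) (E * x)) -mulnA mul2n -addnn in step3 *.
lia.
Qed.

Section CliqueGrowth.
Variables (T : finType) (e : rel T).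
Hypotheses (sym_e : symmetric e) (irr_e : irreflexive e).
Implicit Types (u v : T) (A K S U W X : {set T}).

Definition nbr u := [set v | e u v].

Lemma cliqueU K1 K2 : clique e K1 -> clique e K2 ->
  {in K1 & K2, forall u v, e u v} -> clique e (K1 :|: K2).
Proof.
move=> /cliqueP c1 /cliqueP c2 c12; apply/cliqueP => u v.
rewrite !inE => /orP[u1|u2] /orP[v1|v2] uv; [exact: c1|exact: c12| |exact: c2].
by rewrite sym_e; exact: c12.
Qed.

Lemma clique1 u : clique e [set u].
Proof. by apply/cliqueP => x y /set1P-> /set1P->; rewrite eqxx. Qed.

(** A maximal stable set [A] of [U] has at most [k] vertices and their closed neighbourhoods cover
    [U]. Neighbourhoods forbid a clique one smaller, so by induction each closed one has at most
    [(k+1)^p] vertices. *)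
Lemma ramsey_bound p k U : Kfree e p.+1 U -> alpha_le e k U -> #|U| < k.+1 ^ p.
Proof.
elim: p U => [|p IHp] U fU aU.
  rewrite expn0 ltnS leqn0 cards_eq0; apply/negPn/negP => /set0Pn[u uU].
  have : #|[set u]| < 1 by apply: fU (clique1 u); rewrite sub1set.
  by rewrite cards1.
have [A /maxsetP[/andP[AU sA] maxA]] :
    {A | maxset (fun A => (A \subset U) && stable e A) A}.
  have := @ex_maxset _ (fun A => (A \subset U) && stable e A); apply.
  by exists set0; rewrite sub0set stable0.
have nbr_lt u : u \in A -> #|u |: (nbr u :&: U)| <= k.+1 ^ p.
  move=> uA; rewrite cardsU1 !inE irr_e /= add1n.
  apply: IHp; last exact: alpha_leS (subsetIr _ _) aU.
  move=> K; rewrite subsetI => /andP[/subsetP Ku KU] cK.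
  have uNK : u \notin K by apply/negP => /Ku; rewrite inE irr_e.
  have <- : #|u |: K| = #|K|.+1 by rewrite cardsU1 uNK.
  apply: fU; first by rewrite subUset KU sub1set (subsetP AU).
  apply: cliqueU => // [|x v /set1P-> /Ku]; first exact: clique1.
  by rewrite inE.
have subU : U \subset \bigcup_(u in A) (u |: (nbr u :&: U)).
  apply/subsetP => v vU; apply/bigcupP.
  have [vA|vNA] := boolP (v \in A); first by exists v; rewrite ?inE ?eqxx.
  have [/exists_inP[u uA uv]|/exists_inPn noN] := boolP [exists u in A, e u v].
    by exists u; rewrite // !inE uv vU orbT.
  case/negP: vNA; rewrite -(maxA (v |: A)) ?setU11 ?subsetUr //.
  rewrite subUset sub1set vU AU; apply/stableP => x y.
  rewrite !inE => /predU1P[->|xA] /predU1P[->|yA]; rewrite ?irr_e //; last 1 first.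
  - by move/stableP: sA; apply.
  - by rewrite sym_e noN.
  - by rewrite noN.
apply: leq_ltn_trans (subset_leq_card subU) _.
apply: (@leq_ltn_trans (\sum_(u in A) k.+1 ^ p)).
  elim/big_rec2: _ => [|u n B uA Bn]; first by rewrite cards0.
  by apply: leq_trans (leq_card_setU _ _) _; rewrite leq_add // nbr_lt.
rewrite sum_nat_const expnS ltn_mul2r expn_gt0 /= ltnS; exact: aU.
Qed.

Lemma sum_nbr_swap W K :
  \sum_(v in W) #|nbr v :&: K| = \sum_(u in K) #|nbr u :&: W|.
Proof.
have cardE B v : #|nbr v :&: B| = \sum_(u in B) e v u.
  by rewrite -sum1_card big_mkcond [RHS]big_mkcond /=; apply: eq_bigr => u _;
     rewrite !inE andbC; case: (u \in B); case: (e v u).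
under eq_bigr => v _ do rewrite (cardE K).
rewrite exchange_big /=; apply: eq_bigr => u _; rewrite (cardE W).
by apply: eq_bigr => v _; rewrite sym_e.
Qed.

(** The vertices of [X] leave at most [2^|K|] different traces [nbr v :&: K], so some trace is
    shared by a [2^-|K|] fraction of them. *)
Lemma pigeonhole_nbr X K :
  exists2 S : {set T}, S \subset K & #|X| <= #|[set v in X | nbr v :&: K == S]| * 2 ^ #|K|.
Proof.
pose F (S : {set T}) := #|[set v in X | nbr v :&: K == S]|.
have [/exists_inP[S SK XS]|/exists_inPn noS] :=
  boolP [exists S in powerset K, #|X| <= F S * 2 ^ #|K|].
  by exists S; rewrite // -powersetE.
have F_lt (S : {set T}) : S \in powerset K -> F S * 2 ^ #|K| <= #|X|.-1.
  by move=> /noS; rewrite -ltnNge; case: #|X|.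
have X_gt0 : 0 < #|X|.
  by apply: contraNT (noS set0 _); rewrite ?powersetE ?sub0set // -leqNgt leqn0 => /eqP->.
have : \sum_(S in powerset K) F S * 2 ^ #|K| <= 2 ^ #|K| * #|X|.-1.
  by rewrite -{2}card_powerset -sum_nat_const; exact: leq_sum.
rewrite -big_distrl /= mulnC leq_pmul2l ?expn_gt0 //.
suff -> : \sum_(S in powerset K) F S = #|X| by rewrite -ltnS prednK ?ltnn.
rewrite -[RHS]sum1_card.
rewrite (partition_big (fun v => nbr v :&: K) (mem (powerset K))) /=; last first.
  by move=> v _; rewrite powersetE subsetIr.
apply: eq_bigr => S _.
by rewrite sum1_card /F; apply: eq_card => v; rewrite !inE.
Qed.

(** With [E = 2r^2p], the degree hypothesis says at least [(1 - 1/r - 1/E)|W|], as [E/r = 2rp]. In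
    the size hypothesis, the factor [E] pays for passing to the vertices that see most of [K], and
    [2^(rp)] for fixing their trace [S] on [K]. The new clique is [S] with a [K_p] found among those
    vertices. *)
Lemma clique_step r p W K : 0 < r -> 0 < #|W| -> 
  {in W, forall u, 2 * r ^ 2 * p * #|W| <=
     2 * r ^ 2 * p * #|nbr u :&: W| + (2 * r * p).+1 * #|W|} ->
  (forall U : {set T}, U \subset W -> #|W| <= #|U| * (2 * r ^ 2 * p * 2 ^ (r * p)) ->
     exists K' : {set T}, [/\ K' \subset U, clique e K' & #|K'| = p]) ->
  K \subset W -> clique e K -> #|K| < r * p ->
  exists K' : {set T}, [/\ K' \subset W, clique e K' & #|K| < #|K'|].
Proof.
move=> r_gt0 W_gt0 degW bigW KW cK Krp.
set j := #|K| in Krp *; set m := #|W| in W_gt0 degW bigW.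
set E := 2 * r ^ 2 * p in degW bigW.
pose a := j - j %/ r.
pose X := [set v in W | a <= #|nbr v :&: K|].
have deg_sum : j * (E * m) <= E * \sum_(v in W) #|nbr v :&: K| + j * ((2 * r * p).+1 * m).
  rewrite sum_nbr_swap -sum_nat_const -[j * _]sum_nat_const big_distrr -big_split /=.
  by apply: leq_sum => u /(subsetP KW); exact: degW.
(* Adding 1 per vertex of [W] gives the summand [m]: outside [X] a vertex then counts at most [a],
   inside at most [j + 1]. *)
have sum_le : \sum_(v in W) #|nbr v :&: K| + m <= a * m + #|X| * j.+1.
  rewrite -[m in X in X <= _]sum1_card -big_split /=.
  rewrite (bigID (fun v => a <= #|nbr v :&: K|)) /= addnC leq_add //.
    rewrite mulnC -sum_nat_const big_mkcondr /=.
    by apply: leq_sum => v _; rewrite -ltnNge addn1; case: leqP.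
  rewrite -sum_nat_const; under [X in _ <= X]eq_bigl => v do rewrite inE.
  apply: leq_sum => v _; rewrite addn1 ltnS; exact: subset_leq_card (subsetIr _ _).
have X_big : m <= E * #|X|.
  by apply: growth_arith (divn_eq j r) _ _ Krp deg_sum sum_le;
    rewrite ?ltn_mod ?subnK ?leq_div.
have [S SK XS] := pigeonhole_nbr X K.
set XS' := [set v in X | _] in XS.
have XSW : XS' \subset W by apply/subsetP => v; rewrite !inE => /andP[/andP[]].
have [|K' [K'X cK' K'p]] := bigW XS' XSW.
  apply: leq_trans X_big _; rewrite mulnCA leq_mul2l; apply/orP; right.
  by apply: leq_trans XS _; rewrite leq_mul2l leq_exp2l // ltnW ?orbT.
have K'S v : v \in K' -> nbr v :&: K = S.
  by move=> /(subsetP K'X); rewrite !inE => /andP[_ /eqP].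
have aS : a <= #|S|.
  (* The size of [S] is read off a vertex of [K'], which exists because [|K| < rp] forces
     [p > 0]. *)
  have : 0 < #|K'| by rewrite K'p; case: (p) Krp; rewrite ?muln0.
  case/card_gt0P => v vK'; rewrite -(K'S v vK').
  by have := subsetP K'X v vK'; rewrite !inE => /andP[/andP[]].
exists (S :|: K'); split.
- by rewrite subUset (fintype.subset_trans SK) // (fintype.subset_trans K'X).
- apply: cliqueU cK' _; first exact: sub_clique cK.
  move=> u v uS vK'; rewrite sym_e; move: uS.
  by rewrite -(K'S v vK') !inE => /andP[].
rewrite cardsU disjoint_setI0 ?cards0 ?subn0 ?K'p.
  have : j %/ r < p by rewrite ltn_divLR // mulnC.
  by have := leq_div j r; rewrite /a in aS; lia.
rewrite disjoints_subset; apply/subsetP => v vS; rewrite inE; apply/negP => vK'.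
by move: vS; rewrite -(K'S v vK') !inE irr_e.
Qed.

Lemma clique_growth r p W : 0 < r -> 0 < #|W| ->
  {in W, forall u, 2 * r ^ 2 * p * #|W| <=
     2 * r ^ 2 * p * #|nbr u :&: W| + (2 * r * p).+1 * #|W|} ->
  (forall U : {set T}, U \subset W -> #|W| <= #|U| * (2 * r ^ 2 * p * 2 ^ (r * p)) ->
     exists K' : {set T}, [/\ K' \subset U, clique e K' & #|K'| = p]) ->
  exists K : {set T}, [/\ K \subset W, clique e K & r * p <= #|K|].
Proof.
move=> r_gt0 W_gt0 degW bigW.
suff grow j : j <= r * p -> exists K : {set T}, [/\ K \subset W, clique e K & j <= #|K|].
  exact: grow.
elim: j => [_|j IHj jrp]; first by exists set0; rewrite sub0set clique0.
have [K [KW cK jK]] := IHj (ltnW jrp).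
have [rpK|Krp] := leqP (r * p) #|K|.
  by exists K; split => //; exact: leq_trans rpK.
have [K' [K'W cK' KK']] := clique_step r_gt0 W_gt0 degW bigW KW cK Krp.
by exists K'; split => //; exact: leq_ltn_trans KK'.
Qed.

End CliqueGrowth.

(** * The deletion method *)

Section RandomGraph.

(** A uniform function sends [P] into [A] with probability [(|A|/|C|)^|P|]; here and below
    probabilities appear as counts, cleared of denominators. *)
Lemma card_ffun_on_set (I C : finType) (P : {set I}) (A : pred C) :
  #|[set c : {ffun I -> C} | [forall i in P, A (c i)]]| * #|C| ^ #|P| =
  #|A| ^ #|P| * #|C| ^ #|I|.
Proof.
pose F (i : I) : pred C := if i \in P then A else predT.
have -> : #|[set c : {ffun I -> C} | [forall i in P, A (c i)]]| = #|family F|.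
  apply: eq_card => c; rewrite inE; apply/forall_inP/familyP => [PA i|PA i iP].
    by rewrite /F; case: ifP => // /PA.
  by have := PA i; rewrite /F iP.
rewrite card_family foldrE big_map big_enum /=.
rewrite (bigID (mem P)) /=.
rewrite (eq_bigr (fun=> #|A|)) => [|i iP]; last by rewrite /F iP.
rewrite prod_nat_const (eq_bigr (fun=> #|C|)) => [|i /negbTE iP]; last first.
  by rewrite /F iP; apply: eq_card.
rewrite prod_nat_const -mulnA -expnD; congr (_ * _ ^ _).
by rewrite addnC cardC.
Qed.

Variables (N b : nat).

(** A uniform colouring models the random graph with edge probability [1/(b+1)]: a pair is an edge
    when its colour is 0. *)
Let coloring := {ffun {set 'I_N} -> 'I_b.+1}.

Definition random_rel (c : coloring) : rel 'I_N :=
  fun u v => (u != v) && (c [set u; v] == ord0).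

Lemma random_rel_sym c : symmetric (random_rel c).
Proof. by move=> u v; rewrite /random_rel eq_sym setUC. Qed.

Lemma random_rel_irr c : irreflexive (random_rel c).
Proof. by move=> u; rewrite /random_rel eqxx. Qed.

Let pairs (K : {set 'I_N}) := [set E : {set 'I_N} | E \subset K & #|E| == 2].

Lemma card_clique_colorings (K : {set 'I_N}) :
  #|[set c | clique (random_rel c) K]| * b.+1 ^ 'C(#|K|, 2) <= #|coloring|.
Proof.
have := card_ffun_on_set (pairs K) (pred1 (@ord0 b)).
rewrite card1 exp1n mul1n card_ord cards_draws card_ffun card_ord => <-.
rewrite leq_mul2r; apply/orP; right; apply/subset_leq_card/subsetP => c.
rewrite !inE => /cliqueP cK; apply/forall_inP => E; rewrite inE => /andP[EK].
case/cards2P => u [v [uv EE]]; move: EK; rewrite EE subUset !sub1set => /andP[uK vK].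
by have /andP[] := cK u v uK vK uv.
Qed.

Lemma card_stable_colorings (A : {set 'I_N}) :
  #|[set c | stable (random_rel c) A]| * b.+1 ^ 'C(#|A|, 2) <=
  b ^ 'C(#|A|, 2) * #|coloring|.
Proof.
have := card_ffun_on_set (pairs A) (predC1 (@ord0 b)).
rewrite cardC1 card_ord cards_draws /= card_ffun card_ord => <-.
rewrite leq_mul2r; apply/orP; right; apply/subset_leq_card/subsetP => c.
rewrite !inE => /stableP cA; apply/forall_inP => E; rewrite inE => /andP[EK].
case/cards2P => u [v [uv EE]]; move: EK; rewrite EE subUset !sub1set => /andP[uK vK].
by have := cA u v uK vK; rewrite /random_rel uv.
Qed.

Let ksets k := [set A : {set 'I_N} | #|A| == k].

(** Linearity of expectation over the [k]-sets, [y/x] bounding the probability of each event. *)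
Lemma sum_count_colorings k (P : coloring -> {set 'I_N} -> bool) x y :
  (forall A : {set 'I_N}, #|A| = k -> #|[set c | P c A]| * x <= y * #|coloring|) ->
  (\sum_c #|[set A in ksets k | P c A]|) * x <= 'C(N, k) * y * #|coloring|.
Proof.
move=> PA.
have -> : \sum_c #|[set A in ksets k | P c A]| = \sum_(A in ksets k) #|[set c | P c A]|.
  under eq_bigr => c _ do rewrite -sum1_card big_mkcond.
  rewrite exchange_big [RHS]big_mkcond /=; apply: eq_bigr => A _.
  rewrite -sum1_card [in RHS]big_mkcond /=; case: ifP => Ak; last first.
    by apply: big1 => c _; rewrite !inE in Ak *; rewrite Ak.
  by apply: eq_bigr => c _; rewrite !inE in Ak *; rewrite Ak.
have <- : #|ksets k| = 'C(N, k) by rewrite card_draws card_ord.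
rewrite big_distrl -mulnA -sum_nat_const /=; apply: leq_sum => A.
by rewrite inE => /eqP; exact: PA.
Qed.

(** First moments: the expected number of [t]-cliques is below [(M+1)/2] and that of stable [k]-sets
    at most [1/2]. A bad colouring has [x c + (M+1) * y c >= M+1], so not all colourings are bad. *)
Lemma deletion_coloring t k M :
  2 * 'C(N, k) * b ^ 'C(k, 2) <= b.+1 ^ 'C(k, 2) ->
  2 * 'C(N, t) < M.+1 * b.+1 ^ 'C(t, 2) ->
  exists c, #|[set A in ksets t | clique (random_rel c) A]| <= M /\
            #|[set A in ksets k | stable (random_rel c) A]| = 0.
Proof.
move=> Hk Ht.
pose x c := #|[set A in ksets t | clique (random_rel c) A]|.
pose y c := #|[set A in ksets k | stable (random_rel c) A]|.
have [/existsP[c /andP[xM /eqP y0]]|/existsPn noc] :=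
  boolP [exists c, (x c <= M) && (y c == 0)]; first by exists c.
have sum_ge : M.+1 * #|coloring| <= \sum_c x c + M.+1 * \sum_c y c.
  rewrite mulnC -sum_nat_const big_distrr -big_split /=; apply: leq_sum => c _.
  have := noc c; rewrite negb_and -ltnNge -lt0n => /orP[xM|y0].
    exact: leq_trans xM (leq_addr _ _).
  by apply: leq_trans (leq_addl _ _); rewrite leq_pmulr.
have col_gt0 : 0 < #|coloring| by rewrite card_ffun card_ord expn_gt0.
have sum_x : (\sum_c x c) * b.+1 ^ 'C(t, 2) <= 'C(N, t) * #|coloring|.
  have := @sum_count_colorings t (fun c A => clique (random_rel c) A) (b.+1 ^ 'C(t, 2)) 1.
  rewrite muln1; apply => A At; rewrite mul1n -At.
  by exact: card_clique_colorings.
have sum_y : (\sum_c y c) * b.+1 ^ 'C(k, 2) <= 'C(N, k) * b ^ 'C(k, 2) * #|coloring|.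
  by apply: (@sum_count_colorings k (fun c A => stable (random_rel c) A)) => A <-;
    exact: card_stable_colorings.
have {}sum_y : 2 * \sum_c y c <= #|coloring|.
  have bk_gt0 : 0 < b.+1 ^ 'C(k, 2) by rewrite expn_gt0.
  rewrite -(leq_pmul2r bk_gt0) -mulnA.
  apply: (@leq_trans (2 * ('C(N, k) * b ^ 'C(k, 2) * #|coloring|))).
    by rewrite leq_mul2l sum_y.
  by rewrite !mulnA (mulnC #|coloring|) leq_mul2r Hk orbT.
have {}sum_x : 2 * \sum_c x c < M.+1 * #|coloring|.
  have bt_gt0 : 0 < b.+1 ^ 'C(t, 2) by rewrite expn_gt0.
  rewrite -(ltn_pmul2r bt_gt0) -mulnA.
  apply: (@leq_ltn_trans (2 * ('C(N, t) * #|coloring|))).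
    by rewrite leq_mul2l sum_x.
  by rewrite mulnA (mulnAC M.+1) ltn_pmul2r.
have : 2 * (M.+1 * \sum_c y c) <= M.+1 * #|coloring|.
  by rewrite mulnCA leq_mul2l sum_y orbT.
lia.
Qed.

(* Delete one vertex from each of the at most M cliques of size t. *)
Lemma Q_deletion t k M : 2 <= t -> 0 < k ->
  2 * 'C(N, k) * b ^ 'C(k, 2) <= b.+1 ^ 'C(k, 2) ->
  2 * 'C(N, t) < M.+1 * b.+1 ^ 'C(t, 2) ->
  Q t (N - M) < k.
Proof.
move=> t2 k_gt0 Hk Ht; have [c [xM y0]] := deletion_coloring Hk Ht.
set X := [set A in ksets t | _] in xM.
(* [pick] yields an option; a clique of size [t >= 2] is nonempty, so it does lose a vertex to
   [D]. *)
pose h (A : {set 'I_N}) := [pick u in A].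
pose D := [set u | Some u \in h @: X].
have DM : #|D| <= M.
  apply: leq_trans xM; apply: leq_trans (leq_imset_card h X).
  rewrite -(card_imset D (@Some_inj _)); apply/subset_leq_card/subsetP => o.
  by case/imsetP => u; rewrite inE => uD ->.
rewrite -(prednK k_gt0) ltnS.
have NM : N - M <= #|~: D| by rewrite cardsCs setCK card_ord leq_sub2l.
apply: leq_trans (leq_Q t2 NM) _.
apply: (Q_le (@random_rel_sym c) (@random_rel_irr c)).
  move=> K KD cK; rewrite ltnNge; apply/negP => tK.
  have [A AK At] := exists_sub_card tK.
  have AX : A \in X by rewrite !inE At eqxx (sub_clique AK).
  have : h A \in h @: X by apply: imset_f.
  rewrite {1}/h; case: pickP => [u uA huX|A0].
    have /(subsetP KD) : u \in K by exact: (subsetP AK).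
    by rewrite !inE huX.
  by have : 0 < #|A|; [rewrite At ltnW | rewrite (eq_card0 A0)].
move=> A _ sA; rewrite -ltnS prednK // ltnNge; apply/negP => kA.
have [B BA Bk] := exists_sub_card kA.
have /eqP := y0; rewrite cards_eq0 => /eqP/setP/(_ B); rewrite !inE Bk eqxx /=.
move=> /negP; apply; apply/stableP => u v uB vB.
by move/stableP: sA; apply; exact: (subsetP BA).
Qed.

End RandomGraph.

(** * Elementary estimates and parameters for the deletion method *)

Lemma leq_expn2r m n d : m <= n -> m ^ d <= n ^ d.
Proof. by case: d => // d; rewrite leq_exp2r. Qed.

(** With [c = a %/ (d+1)], [a^d] is at most [((d+1) * 2^c)^d]; once [K * (d+1)^d <= c < 2^c], the
    product is below [2^(c(d+1)) <= 2^a]. *)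
Lemma poly_lt_exp2 K d : exists A, forall a, A <= a -> K * a ^ d < 2 ^ a.
Proof.
exists (d.+1 * (K * d.+1 ^ d)) => a Aa; set c := a %/ d.+1.
have Kc : K * d.+1 ^ d <= c by rewrite leq_divRL // mulnC.
have ac : a <= d.+1 * c.+1 by rewrite mulnC ltnW // ltn_ceil.
apply: (@leq_ltn_trans (K * (d.+1 * 2 ^ c) ^ d)).
  rewrite leq_mul2l leq_expn2r ?orbT //.
  by apply: leq_trans ac _; rewrite leq_mul2l ltn_expl.
apply: (@leq_trans (2 ^ (c * d.+1))); last first.
  by rewrite leq_exp2l // leq_trunc_div.
rewrite expnMn mulnA mulnS expnD expnM ltn_pmul2r ?expn_gt0 //.
by apply: leq_ltn_trans Kc _; rewrite ltn_expl.
Qed.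

Lemma leq_bin_exp n m : 'C(n, m) <= n ^ m.
Proof.
apply: (@leq_trans (n ^_ m)).
  by rewrite -bin_ffact leq_pmulr // fact_gt0.
elim: m n => [|m IHm] [|n] //; rewrite ffactnS expnS leq_mul2l /=.
by apply: leq_trans (IHm _) _; rewrite leq_expn2r.
Qed.

(** The first two binomial terms already suffice. It says that [(b/(b+1))^(b+1)] is at most
    [1/2]. *)
Lemma Bernoulli_exp2 b : 2 * b ^ b.+1 <= b.+1 ^ b.+1.
Proof.
rewrite -[X in _ <= X ^ _]addn1 expnDn big_ord_recl big_ord_recl /= subn0 bin0 mul1n !exp1n !muln1.
rewrite /bump /= add1n bin1 subn1 /= addnA mul2n -addnn -addnA leq_add2l.
by apply: leq_trans (leq_addr _ _); rewrite expnS leq_mul2r leqnSn orbT.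
Qed.

Section QUpperBound.
Variables (q n : nat).
Hypotheses (q_gt0 : 0 < q) (n_gt0 : 0 < n).
Let t := q.*2.+1.

Lemma card_pairs_odd : 'C(t, 2) = q * t.
Proof. by rewrite bin2odd /t /= ?odd_double //= doubleK mulnC. Qed.

(** Deletion with [N = 2n] and [M = n]. As [C(k,2) = (b+1) * k * (a+1)], a [k]-set is stable with
    probability at most [2^-(k(a+1))], against at most [2^(ak)] such sets. *)
Lemma Q_le_params b a : 16 * n ^ 2 <= b.+1 ^ t -> 2 * n <= 2 ^ a ->
  Q t n < (2 * b.+1 * a.+1).+1.
Proof.
move=> nb na; set k := (2 * b.+1 * a.+1).+1.
have Ck : 'C(k, 2) = b.+1 * (k * a.+1).
  have k1 : k.-1 = 2 * b.+1 * a.+1 by [].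
  have -> : b.+1 * (k * a.+1) = (b.+1 * (k * a.+1)).*2./2 by rewrite doubleK.
  by rewrite bin2 k1 -mul2n; congr _./2; clearbody k; lia.
rewrite -[n](_ : 2 * n - n = n); last by lia.
apply: (@Q_deletion _ b); rewrite ?Ck ?card_pairs_odd //.
  by rewrite /t ltnS double_gt0.
  rewrite (expnM b b.+1) (expnM b.+1 b.+1).
  apply: (@leq_trans (2 ^ (k * a.+1) * (b ^ b.+1) ^ (k * a.+1))).
    rewrite leq_mul2r; apply/orP; right.
    apply: (@leq_trans (2 * (2 ^ a) ^ k)).
      by rewrite leq_mul2l (leq_trans (leq_bin_exp _ _)) // leq_expn2r.
    by rewrite -expnM -expnS leq_exp2l //; lia.
  by rewrite -expnMn leq_expn2r // Bernoulli_exp2.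
(* For the cliques: [2 * (2n)^t = 4 * 4^q * n^t], and [4 * 4^q <= 16^q] since [q > 0]. *)
apply: (@leq_ltn_trans (n * (16 * n ^ 2) ^ q)); last first.
  rewrite mulnC (mulnC q) expnM; apply: (@leq_ltn_trans ((b.+1 ^ t) ^ q * n)).
    by rewrite leq_mul2r leq_expn2r ?orbT.
  by rewrite mulnC ltn_pmul2r ?expn_gt0.
apply: (@leq_trans (2 * (2 * n) ^ t)); first by rewrite leq_mul2l leq_bin_exp orbT.
have : 4 * 4 ^ q <= 16 ^ q.
  case: q q_gt0 => // q' _; rewrite [16 ^ _]expnS [4 ^ _]expnS mulnA.
  by rewrite leq_mul2l leq_expn2r.
move=> h4; have e1 : (2 * n) ^ q.*2 = 4 ^ q * (n ^ 2) ^ q.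
  by rewrite -mul2n expnM expnMn expnMn.
rewrite /t expnS e1 expnMn; set y := (n ^ 2) ^ q.
have : 4 * 4 ^ q * (n * y) <= 16 ^ q * (n * y) by rewrite leq_mul2r h4 orbT.
by clearbody y; move: (4 ^ q) (16 ^ q) => c d; lia.
Qed.

End QUpperBound.

(** For [t = 2q+1], [Q t n] is at most [n^(2/t)] up to logarithms, and [2q/t < 1]. The inequality is
    compared in [t]-th powers to keep exponents integral. *)
Lemma Q_small q C : 0 < q ->
  exists n0, forall n, n0 <= n -> C * (Q q.*2.+1 n).+1 ^ q < n.
Proof.
move=> q_gt0; set t := q.*2.+1.
(* The 8 comes from [2^(a+1) <= 8n] for the [a] chosen below. *)
pose D := 8 * (C ^ t * (3 ^ t * (2 ^ t * 16)) ^ q).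
have [A HA] := poly_lt_exp2 D (q * t).
exists (2 ^ A).+1 => n n_gt; have n_gt0 : 0 < n by exact: leq_ltn_trans n_gt.
pose a := (trunc_log 2 (2 * n)).+1.
have /andP[an na] : 2 ^ a.-1 <= 2 * n < 2 ^ a.
  by apply: trunc_log_bounds => //; rewrite muln_gt0.
have Aa : A <= a.+1.
  by rewrite -(leq_exp2l _ _ (ltnSn 1)) expnS; lia.
have exb : exists b, 16 * n ^ 2 <= b ^ t.
  exists (16 * n ^ 2); rewrite /t (expnS (16 * _)) leq_pmulr //.
  by rewrite expn_gt0 muln_gt0 expn_gt0 n_gt0.
have [b nb bmin] := ex_minnP exb.
have b_gt1 : 1 < b.
  rewrite ltnNge; apply/negP => b1; have : b ^ t <= 1 by rewrite -(exp1n t) leq_expn2r.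
  by have : 0 < n ^ 2 by [rewrite expn_gt0 n_gt0]; lia.
(* Minimality of [b] bounds [(b-1)^t], and [b <= 2(b-1)]. *)
have bt : b ^ t <= 2 ^ t * (16 * n ^ 2).
  apply: (@leq_trans ((2 * b.-1) ^ t)); first by apply: leq_expn2r; lia.
  rewrite expnMn leq_mul2l ltnW ?orbT // ltnNge; apply/negP => /bmin; lia.
have bE : b = b.-1.+1 by rewrite prednK // ltnW.
have Qk : (Q t n).+1 <= 3 * (b * a.+1).
  rewrite bE in nb; apply: leq_trans (Q_le_params q_gt0 n_gt0 nb (ltnW na)) _.
  rewrite -bE; have : 0 < b * a.+1 by rewrite muln_gt0 ltnW.
  lia.
have t_gt0 : 0 < t by [].
rewrite -(ltn_exp2r _ _ t_gt0) expnMn -expnM mulnC.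
apply: (@leq_ltn_trans ((3 ^ t * (2 ^ t * 16)) ^ q * a.+1 ^ (q * t) * n ^ q.*2 * C ^ t)).
  rewrite mulnC [X in _ <= X]mulnC leq_mul2l; apply/orP; right.
  apply: leq_trans (leq_expn2r _ Qk) _.
  rewrite -(mul2n q) (expnM n) (mulnC q t) (expnM a.+1) -!(expnMn _ _ q) expnM.
  apply: leq_expn2r; rewrite (expnMn 3) (expnMn b).
  have := leq_mul (leqnn (3 ^ t)) (leq_mul bt (leqnn (a.+1 ^ t))).
  move: (3 ^ t) (b ^ t) (a.+1 ^ t) (2 ^ t) (n ^ 2) => x1 x2 x3 x4 x5.
  lia.
have := HA _ Aa; rewrite expnS /D; set c := (3 ^ t * _) ^ q; set d := a.+1 ^ (q * t).
move=> Dlt; have {Dlt}: C ^ t * c * d < n.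
  have : 2 ^ a = 2 * 2 ^ a.-1 by rewrite -expnS.
  move: (2 ^ a) (2 ^ a.-1) an na Dlt => x y yn nx Dlt xy.
  by move: Dlt; rewrite -!mulnA; move: (C ^ t * (c * d)) => z; lia.
rewrite -(@ltn_pmul2r (n ^ q.*2)) ?expn_gt0 ?n_gt0 // -expnS.
by congr (_ < _); lia.
Qed.

(** * Edge bounds *)

Lemma clique_or_Kfree (T : finType) (e : rel T) p (U : {set T}) :
  (exists K : {set T}, [/\ K \subset U, clique e K & #|K| = p]) \/ Kfree e p U.
Proof.
have [/existsP[K /and3P[? ? /eqP ?]]|/existsPn noK] :=
  boolP [exists K : {set T}, [&& K \subset U, clique e K & #|K| == p]].
  by left; exists K.
right=> K KU cK; rewrite ltnNge; apply/negP => pK.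
have [A AK Ap] := exists_sub_card pK.
by have := noK A; rewrite (fintype.subset_trans AK) // (sub_clique AK) // Ap eqxx.
Qed.

(** Adding [u] to a stable set of its non-neighbours keeps it stable, so these induce independence
    number below [Q t n <= Q t m]; hence there are fewer than [m] of them. *)
Lemma card_nbr_Q_jump t n m (e : rel 'I_n) u : 2 <= t ->
  symmetric e -> irreflexive e -> Kfree e t [set: 'I_n] ->
  alpha_le e (Q t n) [set: 'I_n] -> Q t n <= Q t m -> n <= #|nbr e u| + m.
Proof.
move=> t2 sym_e irr_e fe ae nm; pose X := ~: (u |: nbr e u).
have n_gt0 : 0 < n by exact: leq_ltn_trans (ltn_ord u).
have Q_gt0 := Q_gt0 t2 n_gt0.
have XQ : Q t #|X| <= (Q t n).-1.
  apply: (Q_le sym_e irr_e (KfreeS (finset.subsetT _) fe)) => A AX /stableP sA.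
  have uA : u \notin A by apply/negP => /(subsetP AX); rewrite !inE eqxx.
  have <- : #|u |: A|.-1 = #|A| by rewrite cardsU1 uA.
  suff : #|u |: A| <= Q t n by case: #|_| => // a; case: (Q t n).
  apply: ae; first exact: finset.subsetT.
  have uX v : v \in A -> ~~ e u v.
    by move=> /(subsetP AX); rewrite !inE negb_or => /andP[].
  apply/stableP => v w /setU1P[->|vA] /setU1P[->|wA]; rewrite ?irr_e ?uX //.
    by rewrite sym_e uX.
  exact: sA.
have Xm : #|X| < m.
  rewrite ltnNge; apply/negP => mX; have := leq_Q t2 mX.
  by have := prednK Q_gt0; lia.
have := cardsC (u |: nbr e u); rewrite -/X card_ord cardsU1 !inE irr_e /=.
by move: Xm; move: #|X| #|nbr e u| => x y; clear; lia.
Qed.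

(* If Q did not drop, an extremal graph would have minimum degree about n/2;
   clique_growth then yields a linear-size set without cliques of size
   ceil(t/2), and ramsey_bound contradicts Q_small. *)
Lemma Q_half_lt t : 2 <= t -> exists n0, forall n, n0 <= n -> Q t n./2.+1 < Q t n.
Proof.
(* [2p >= t] makes [K_{2p}] forbidden, while [2q+1 <= t] lets [Q_small] apply through [Q_anti]. *)
move=> t2; pose p := uphalf t; pose q := p.-1.
have p_gt0 : 0 < p by rewrite /p; lia.
pose C := 2 * 2 ^ 2 * p * 2 ^ (2 * p).
have [n0 Hn0] : exists n0, forall n, n0 <= n -> C * (Q t n).+1 ^ q < n.
  have [q0|q_gt0] := posnP q.
    by exists C.+1 => n; rewrite q0 expn0 muln1.
  have [n0 Hn0] := Q_small C q_gt0; exists n0 => n nn.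
  apply: leq_ltn_trans (Hn0 n nn); rewrite leq_mul2l leq_expn2r ?orbT // ltnS.
  by apply: Q_anti; rewrite /q /p; lia.
(* For [r = 2] the degree slack is [n/(8p)], which covers the [+ 1] in [n./2.+1] once [n >= 8p]. *)
exists (maxn n0 (8 * p)).+1 => n; rewrite gtn_max => /andP[nn0 np].
rewrite ltnNge; apply/negP => nQ.
have [e [sym_e irr_e fe ae]] := Q_attained n t2.
have cardT : #|[set: 'I_n]| = n by rewrite cardsT card_ord.
have [||u _|U _ nU|K [_ cK pK]] := @clique_growth _ e sym_e irr_e 2 p [set: 'I_n].
- by [].
- by rewrite cardT; lia.
- have := card_nbr_Q_jump u t2 sym_e irr_e fe ae nQ; rewrite finset.setIT cardT.
  move: #|nbr e u| => d; clearbody p; have := odd_double_half n; rewrite -mul2n.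
  move: n./2 => h; case: (odd n) => /= nE nd; nia.
- have [//|fU] := clique_or_Kfree e p U; have pE := prednK p_gt0.
  rewrite -pE in fU.
  have := ramsey_bound sym_e irr_e fU (alpha_leS (finset.subsetT _) ae).
  rewrite cardT -/C in nU; have := Hn0 n (ltnW nn0) => n_gt Ulk.
  suff : n < n by rewrite ltnn.
  apply: leq_ltn_trans nU (leq_ltn_trans _ n_gt).
  by rewrite mulnC leq_mul2l ltnW ?orbT.
have := fe K (finset.subsetT _) cK; rewrite ltnNge => /negP; apply.
by apply: leq_trans pK; rewrite /p; lia.
Qed.

(** Restrict the join of [r] extremal graphs on [m] vertices to [n] of its vertices. Non-neighbours
    of a vertex lie in its own part, so all degrees are at least [n - m]. *)
Lemma multipartite_graph r t n m : 2 <= t -> n <= r * m -> Q t m < Q t n ->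
  exists G : sgraph 'I_n, [/\ is_free (complete_graph (r * t.-1).+1) G,
    alpha G < Q t n & n * n <= 2 * #|edges G| + n * m].
Proof.
move=> t2 nrm mn; have [e [sym_e irr_e fe ae]] := Q_attained m t2.
have nI : n <= #|{: 'I_r * 'I_m}| by rewrite card_prod !card_ord.
pose f (i : 'I_n) : 'I_r * 'I_m := enum_val (widen_ord nI i).
have f_inj : injective f by move=> i j /enum_val_inj/(congr1 val)/= ij; exact: val_inj.
pose e' : rel 'I_n := fun i j => join e (f i) (f j).
have sym_e' : symmetric e' by move=> i j; rewrite /e' /join eq_sym sym_e.
have irr_e' : irreflexive e' by move=> i; rewrite /e' /join eqxx irr_e.
have adjE := adj_graph_of sym_e' irr_e'.
exists (graph_of e'); split.
- apply/is_freeP/(Kfree_imset f_inj adjE)/(KfreeS (finset.subsetT _)).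
  by rewrite -[r in (r * _).+1](card_ord r); apply: Kfree_join; rewrite prednK // ltnW.
- apply: leq_ltn_trans mn; apply/alphaP/(alpha_le_imset f_inj adjE).
  by apply: alpha_leS (finset.subsetT _) _; exact: alpha_le_join.
have sumC x : n * x = \sum_(u < n) x by rewrite sum_nat_const card_ord.
rewrite handshake [n * n]sumC [n * m]sumC -big_split /=; apply: leq_sum => u _.
have := cardsC [set v | adj (graph_of e') u v]; rewrite card_ord => {1}<-.
rewrite leq_add2l -[X in _ <= X](card_ord m).
rewrite -(card_in_imset (f := fun v => (f v).2)) ?max_card // => v w.
rewrite !inE !adjE /e' /join !negb_or !negbK => /andP[/eqP uv _] /andP[/eqP uw _] vw.
by apply: f_inj; rewrite [f v]surjective_pairing -uv uw vw -surjective_pairing.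
Qed.

(** * Dense graphs contain large cliques *)

Section UpperBound.
Variables (T : finType) (e : rel T).
Hypotheses (sym_e : symmetric e) (irr_e : irreflexive e).
Implicit Types A B U : {set T}.

Lemma deg_sum_setD1 A u : u \in A ->
  \sum_(v in A) #|nbr e v :&: A| =
  \sum_(v in A :\ u) #|nbr e v :&: (A :\ u)| + 2 * #|nbr e u :&: A|.
Proof.
move=> uA; rewrite (big_setD1 u) //= mul2n -addnn addnA addnC; congr (_ + _).
have -> : #|nbr e u :&: A| = \sum_(v in A :\ u) e v u.
  rewrite -sum1_card big_mkcond [RHS]big_mkcond /=; apply: eq_bigr => v _.
  by rewrite !inE sym_e; have [->|_] := eqVneq v u; rewrite ?irr_e //=;
    case: (v \in A); case: (e v u).
rewrite -big_split /=; apply: eq_bigr => v _.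
rewrite (cardsD1 u (nbr e v :&: A)) !inE uA andbT addnC; congr (#|_| + _).
by rewrite setIDA.
Qed.

(** Delete vertices of too small degree one by one. Each deletion lowers the left side by [2c|A|]
    and the right side by less, so the hypothesis persists; it fails for the empty set, so the
    process stops. *)
Lemma min_degree_subset (c E X : nat) A :
  c * (#|A| * #|A|.+1) + X < E * \sum_(v in A) #|nbr e v :&: A| ->
  exists B, X < E * #|B| ^ 2 /\ {in B, forall u, c * #|B| <= E * #|nbr e u :&: B|}.
Proof.
move: {2}#|A| (leqnn #|A|) => a; elim: a A => [|a IHa] A Aa HA.
  by move: HA; move: Aa; rewrite leqn0 cards_eq0 => /eqP->; rewrite big_set0 muln0.
have [/exists_inP[u uA]|/exists_inPn noA] :=
  boolP [exists u in A, E * #|nbr e u :&: A| < c * #|A|].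
  move=> u_lt; have A1 := cardsD1 u A; rewrite uA add1n in A1.
  apply: (IHa (A :\ u)); first by rewrite -ltnS -A1.
  rewrite (deg_sum_setD1 uA) in HA; move: HA u_lt; rewrite A1.
  move: (\sum_(v in _) _) #|_ :&: _| #|_ :\ _| => s d b; nia.
exists A; split=> [|u /noA]; last by rewrite -leqNgt.
apply: leq_ltn_trans (leq_trans HA _); first exact: leq_addl.
rewrite leq_mul2l -mulnn -sum_nat_const; apply/orP; right.
by apply: leq_sum => v _; exact: subset_leq_card (subsetIr _ _).
Qed.

(** Otherwise [min_degree_subset] with [X = n^2/2] gives [B] with [n <= 2E|B|] on which
    [clique_growth] yields a [K_{rt}]. The constant multiplies the losses of these two steps. *)
Lemma sparse_of_no_clique r t (E := 2 * r ^ 2 * t) : 0 < r -> 0 < t ->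
  Kfree e (r * t) [set: T] ->
  (forall U, #|T| <= #|U| * (2 * E * (E * 2 ^ (r * t))) -> ~ Kfree e t U) ->
  2 * E * \sum_u #|nbr e u| <=
    2 * ((E - (2 * r * t).+1) * (#|T| * #|T|.+1)) + #|T| ^ 2.
Proof.
move=> r_gt0 t_gt0 fT noU; set n := #|T|; set c := E - _.
rewrite leqNgt; apply/negP => big.
have sumT : \sum_u #|nbr e u| = \sum_(u in [set: T]) #|nbr e u :&: [set: T]|.
  by apply: eq_big => [u|u _]; rewrite ?inE // finset.setIT.
have [|B [XB degB]] := @min_degree_subset c E (n ^ 2)./2 [set: T].
  rewrite -sumT cardsT -/n; move: big; move: (\sum_u _) => s.
  have := odd_double_half (n ^ 2); rewrite -mul2n; lia.
have E_gt0 : 0 < E by rewrite /E !muln_gt0 r_gt0 t_gt0.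
have nB : n <= 2 * E * #|B|.
  rewrite -(leq_exp2r _ _ (ltn0Sn 1)) expnMn.
  apply: (@leq_trans (2 * E * #|B| ^ 2)).
    by have := odd_double_half (n ^ 2); rewrite -mul2n; lia.
  by rewrite leq_mul2r [(2 * E) ^ 2]expnS leq_pmulr ?orbT // expn1 muln_gt0 E_gt0.
have [||u uB|U UB BU|K [_ cK Kb]] := @clique_growth _ e sym_e irr_e r t B.
- exact: r_gt0.
- by rewrite lt0n; apply/eqP => B0; rewrite B0 exp0n // muln0 in XB.
- have := degB u uB; rewrite -/E /c mulnBl; lia.
- have [//|fU] := clique_or_Kfree e t U; case: (noU U _ fU).
  by rewrite -/n (leq_trans nB) // mulnCA leq_mul2l BU orbT.
by have := fT K (finset.subsetT _) cK; rewrite ltnNge Kb.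
Qed.

End UpperBound.

Section EdgeCounts.
Variables (r t n : nat).
Hypotheses (r_ge2 : 2 <= r) (t_gt0 : 0 < t).
Let E := 2 * r ^ 2 * t.

Let E_eq : E = r * (2 * (r * t)).
Proof. by rewrite /E -mulnn -!mulnA; lia. Qed.

(** [(1/2)(1 - 1/r)] is [(4E - 8rt)/(8E)]. The degree slack lowers the numerator by 4, the term
    [n^2] gives back 2, and [n+1] in place of [n] at most 1. *)
Lemma upper_edge_count m : 4 * E <= n ->
  2 * E * (2 * m) <= 2 * ((E - (2 * r * t).+1) * (n * n.+1)) + n ^ 2 ->
  m * (8 * E) <= (4 * E - 8 * (r * t) - 1) * n ^ 2.
Proof.
have rt_gt0 : 0 < r * t by rewrite muln_gt0 t_gt0 ltnW.
have rtE : 2 * (2 * (r * t)) <= E by rewrite E_eq leq_mul2r r_ge2 orbT.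
rewrite -(mulnA 2 r t) -mulnn; move: (r * t) E rt_gt0 rtE => x y x_gt0 xy yn H.
have [c yE] : exists c, y = c + (2 * x).+1 by exists (y - (2 * x).+1); lia.
have -> : 4 * y - 8 * x - 1 = 4 * c + 3 by lia.
move: H; have -> : y - (2 * x).+1 = c by lia.
have : 4 * c * n <= n * n by rewrite leq_mul2r; lia.
rewrite mulnS; move: yn; clear; nia.
Qed.

(** Rounding the part size up costs at most [n/2] edges, which is at most [n^2/(16E)] once
    [n >= 8E]. *)
Lemma lower_edge_count m : 8 * E <= n -> n * n <= 2 * m + n * (n %/ r).+1 ->
  (2 * (4 * E - 8 * (r * t) - 1) + 1) * n ^ 2 <= m * (2 * (8 * E)).
Proof.
move=> En H.
have rn : r * (n %/ r) <= n by rewrite mulnC leq_trunc_div.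
have H2 : r * (n * n) <= 2 * (r * m) + n * n + r * n.
  have : r * (n * n) <= r * (2 * m + n * (n %/ r).+1) by rewrite leq_mul2l H orbT.
  have : n * (r * (n %/ r)) <= n * n by rewrite leq_mul2l rn orbT.
  by rewrite mulnS; lia.
have H3 : 8 * (E * (n * n)) <= 16 * (E * m) + 16 * (r * t * (n * n)) + 8 * (E * n).
  have := leq_mul (leqnn (16 * (r * t))) H2; rewrite E_eq; lia.
have H4 : 8 * (E * n) <= n * n by rewrite mulnA leq_mul2r En orbT.
have rt_gt0 : 0 < r * t by rewrite muln_gt0 t_gt0 ltnW.
have rtE : 2 * (2 * (r * t)) <= E by rewrite E_eq leq_mul2r r_ge2 orbT.
rewrite -mulnn; move: H3 H4 rtE rt_gt0; move: (r * t) E => x y H3 H4 xy x_gt0.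
have [c yE] : exists c, 4 * y = 8 * x + 1 + c.
  by exists (4 * y - (8 * x + 1)); lia.
have -> : 4 * y - 8 * x - 1 = c by lia.
have : 8 * (y * (n * n)) = 2 * ((8 * x + 1 + c) * (n * n)) by rewrite -yE; lia.
lia.
Qed.

End EdgeCounts.

(** * Densities *)

(* Imported only here because classical_sets shadows the finset notations. *)
From mathcomp Require Import all_classical all_reals all_analysis.
Import Order.TTheory GRing.Theory Num.Theory.
Import numFieldNormedType.Exports.

Section Limits.
Variable R : realType.
Local Open Scope ring_scope.
Local Open Scope classical_set_scope.

Lemma limn_esup_le_near (u : (\bar R)^nat) (l : \bar R) N :
  (forall n, (N <= n)%N -> u n <= l)%E -> (limn_esup u <= l)%E.
Proof.
move=> ul; rewrite /limn_esup limf_esupE.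
apply: (@le_trans _ _ (ereal_sup (u @` [set n | (N <= n)%N]))).
  by apply: ereal_inf_lbound; exists [set n | (N <= n)%N] => //; exact: nbhs_infty_ge.
by apply: ge_ereal_sup => _ [n /= Nn <-]; exact: ul.
Qed.

Lemma limn_einf_ge_near (u : (\bar R)^nat) (l : \bar R) N :
  (forall n, (N <= n)%N -> l <= u n)%E -> (l <= limn_einf u)%E.
Proof.
move=> lu; rewrite /limn_einf leeNr; apply: (@limn_esup_le_near _ _ N) => n Nn.
by rewrite leeN2 lu.
Qed.

Lemma RT_density_le (V : finType) (H : sgraph V) (f : nat -> R) (n a M : nat) :
  (0 < n)%N -> (0 < M)%N -> (RT n H (f n) * M <= a * n ^ 2)%N ->
  (RT_density H f n <= (a%:R / M%:R)%:E)%E.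
Proof.
move=> n0 M0 le_n; rewrite /RT_density lee_fin.
rewrite ler_pdivrMr ?exprn_gt0 ?ltr0n // mulrAC ler_pdivlMr ?ltr0n //.
by rewrite -natrX -!natrM ler_nat.
Qed.

Lemma RT_density_ge (V : finType) (H : sgraph V) (f : nat -> R) (n a M : nat) :
  (0 < n)%N -> (0 < M)%N -> (a * n ^ 2 <= RT n H (f n) * M)%N ->
  ((a%:R / M%:R)%:E <= RT_density H f n)%E.
Proof.
move=> n0 M0 le_n; rewrite /RT_density lee_fin.
rewrite ler_pdivlMr ?exprn_gt0 ?ltr0n // mulrAC ler_pdivrMr ?ltr0n //.
by rewrite -natrX -!natrM ler_nat.
Qed.

End Limits.

(** Otherwise [Q t n <= C * Q t #|U| <= C * k] by [Q_mul]. *)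
Lemma not_Kfree_of_small_alpha t n C (e : rel 'I_n) k (U : {set 'I_n}) :
  (2 <= t)%N -> symmetric e -> irreflexive e -> alpha_le e k [set: 'I_n]%SET ->
  (C * k < Q t n)%N -> (n <= #|U| * C)%N -> ~ Kfree e t U.
Proof.
move=> t2 sym_e irr_e ae kQ nU fU.
have Qk := Q_le sym_e irr_e fU (alpha_leS (finset.subsetT _) ae).
have := leq_trans (leq_Q t2 nU) _; rewrite mulnC => /(_ _ (Q_mul C #|U| t2)).
by rewrite leqNgt (leq_ltn_trans _ kQ) // leq_mul2l Qk orbT.
Qed.

Lemma RT_le_of_small_alpha (R : realType) (s t r n : nat) (x : R) :
  let E := (2 * r ^ 2 * t)%N in
  (2 <= t)%N -> (2 <= r)%N -> (s <= r * t)%N -> (4 * E <= n)%N ->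
  ((2 * E * (E * 2 ^ (r * t)))%:R * x <= (Q t n)%:R)%R ->
  (RT n (complete_graph s) x * (8 * E) <= (4 * E - 8 * (r * t) - 1) * n ^ 2)%N.
Proof.
move=> E t2 r2 srt En xQ; rewrite /RT.
elim/big_ind: _ => [|m1 m2|G /andP[fG aG]]; first by rewrite mul0n.
  by rewrite maxnMl geq_max => -> ->.
have t_gt0 := ltnW t2; have r_gt0 := ltnW r2.
apply: upper_edge_count => //; rewrite handshake.
have aQ : (2 * E * (E * 2 ^ (r * t)) * alpha G < Q t n)%N.
  rewrite -(ltr_nat R) natrM; apply: lt_le_trans xQ; rewrite ltr_pM2l //.
  by rewrite ltr0n !muln_gt0 expn_gt0 r_gt0 t_gt0.
have := sparse_of_no_clique (adj_sym G) (adj_irr G) r_gt0 t_gt0.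
rewrite -/E card_ord; apply.
  by apply: Kfree_leq srt _; apply/is_freeP.
move=> U nU; apply: (not_Kfree_of_small_alpha t2 (adj_sym G) (adj_irr G) _ aQ nU).
exact/alphaP.
Qed.

Theorem theorem3p7 (R : realType) (s t r l : nat)
    (ht : (2 <= t)%N) (hts : (t < s)%N)
    (hs : (s - 1)%N = (r * (t - 1) + l)%N)
    (hl : (l < t - 1)%N) (hlr : (l < r)%N) :
  strong_phase_transition (complete_graph s) (fun n : nat => ((Q t n)%:R : R)%R).
Proof.
(* [r = 1] would force [l = 0] and [s = t]. *)
have r2 : (2 <= r)%N by nia.
(* From [l < r]: [s - 1 <= r(t-1) + r - 1]. *)
have srt : (s <= r * t)%N by nia.
have rs : ((r * t.-1).+1 <= s)%N by rewrite -subn1; lia.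
have t_gt0 := ltnW ht; have r_gt0 := ltnW r2.
pose E := (2 * r ^ 2 * t)%N.
have E_gt0 : (0 < E)%N by rewrite /E !muln_gt0 r_gt0 t_gt0.
pose C := (2 * E * (E * 2 ^ (r * t)))%N.
have C_gt0 : (0 < C)%N by rewrite !muln_gt0 expn_gt0 r_gt0 t_gt0.
move=> phi phi_gt0 phi0.
have [N HN] : exists N, forall n, (N <= n)%N -> (C%:R * phi n <= 1)%R.
  have Ci : (0 < C%:R^-1 :> R)%R by rewrite invr_gt0 ltr0n.
  have [N _ HN] := cvgr0_norm_lt _ phi0 _ Ci.
  exists N => n Nn; have := HN n Nn; rewrite gtr0_norm //= => /ltW.
  by rewrite -(ler_pM2l (_ : 0 < C%:R)%R) ?ltr0n // divff ?pnatr_eq0 -?lt0n.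
have phi_Q n : (N <= n)%N -> (C%:R * (phi n * (Q t n)%:R) <= (Q t n)%:R :> R)%R.
  by move=> Nn; rewrite mulrA ler_piMl ?ler0n ?HN.
split.
  exists N => // n /= Nn; apply: le_trans (phi_Q n Nn).
  by rewrite ler_peMl ?mulr_ge0 ?ler0n ?(ltW (phi_gt0 n)) // ler1n.
(* The two densities are separated by [a/(8E) < (2a+1)/(16E)], both below
   [(1/2)(1 - 1/r) = (a+1)/(8E)]. *)
set a := (4 * E - 8 * (r * t) - 1)%N.
have [n0 Hn0] := Q_half_lt ht.
apply: (@le_lt_trans _ _ (a%:R / (8 * E)%:R)%:E).
  apply: (@limn_esup_le_near _ _ _ (maxn N (4 * E))) => n; rewrite geq_max => /andP[Nn En].
  apply: RT_density_le; [by lia|by lia|].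
  exact: RT_le_of_small_alpha (phi_Q n Nn).
apply: (@lt_le_trans _ _ ((2 * a + 1)%:R / (2 * (8 * E))%:R)%:E).
  rewrite lte_fin ltr_pdivrMr ?ltr0n; last by lia.
  rewrite mulrAC ltr_pdivlMr ?ltr0n; last by lia.
  by rewrite -!natrM ltr_nat; lia.
apply: (@limn_einf_ge_near _ _ _ (maxn n0 (8 * E))) => n; rewrite geq_max => /andP[nn0 En].
have [|||G [fG aG eG]] := @multipartite_graph r t n (n %/ r).+1.
- exact: ht.
- by rewrite mulnC ltnW // ltn_ceil.
(* Since [r >= 2], parts have at most [n./2.+1] vertices. *)
- apply: leq_ltn_trans (Hn0 n nn0); apply: leq_Q => //.
  by rewrite ltnS -divn2 leq_div2l.
apply: RT_density_ge; [by lia|by lia|].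
apply: leq_trans (lower_edge_count r2 t_gt0 En eG) _.
rewrite leq_mul2r; apply/orP; right; rewrite /RT.
apply: (@leq_bigmax_cond _ _ (fun G : sgraph 'I_n => #|edges G|) G).
rewrite ltr_nat aG andbT; apply/is_freeP; apply: Kfree_leq rs _.
exact/is_freeP.
Qed.
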